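(* Let $r,d>1$ be integers and let $S_{r,d}=F/F^{(d)}$ be the free solvable group of rank $r$ and derived length $d$. Then the conjugacy length function $\mathrm{CLF}_{S_{r,d}}$ is bounded above by a cubic polynomial, i.e. there is a polynomial $p$ of degree $3$ such that $\mathrm{CLF}_{S_{r,d}}(n)\leq p(n)$ for all $n\in\mathbb{N}$.
   Context: $F$ is the free group of rank $r$ on $x_1,\ldots,x_r$; $F^{(0)}=F$, $F^{(d)}=[F^{(d-1)},F^{(d-1)}]$ is the $d$-th derived subgroup, and $S_{r,d}=F/F^{(d)}$, equipped with the word length $|\cdot|$ with respect to the images of $x_1,\ldots,x_r$. For a group $\Gamma$ with a finite generating set and corresponding word length $|\cdot|$, the conjugacy length function $\mathrm{CLF}_\Gamma:\mathbb{N}\to\mathbb{N}$ is $$\mathrm{CLF}_\Gamma(n)=\max\{\min\{|w| : w\in\Gamma,\ wu=vw\} : u,v\in\Gamma,\ |u|+|v|\leq n,\ u \text{ is conjugate to } v \text{ in }\Gamma\}.$$ *)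

(* Defs.v *)
From HB Require Import structures.
From mathcomp Require Import all_boot generic_quotient boolp classical_sets.

Set Implicit Arguments.
Unset Strict Implicit.
Unset Printing Implicit Defensive.

Local Open Scope classical_set_scope.
Local Open Scope group_scope.

(* The letter [(x, false)] stands for x and [(x, true)] for x^-1. *)
Section Words.
Variable X : choiceType.
Implicit Types (a b : X * bool) (u v w s : seq (X * bool)).

Definition letter_inv a : X * bool := (a.1, ~~ a.2).

Definition word_inv w := rev (map letter_inv w).

Definition reduced w := sorted (fun a b => b != letter_inv a) w.

Definition cons_reduce a s :=
  if s is b :: s' then if b == letter_inv a then s' else a :: s else [:: a].

Definition reduce w := foldr cons_reduce [::] w.

Lemma letter_invK : involutive letter_inv.
Proof. by case=> x b; rewrite /letter_inv /= negbK. Qed.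

Lemma cons_reduce_reduced a s : reduced s -> reduced (cons_reduce a s).
Proof.
case: s => [|b s] //= Hs; case: eqP => [_|/eqP ne] /=; last by rewrite ne.
exact: path_sorted Hs.
Qed.

Lemma foldr_reduced s w : reduced s -> reduced (foldr cons_reduce s w).
Proof. by move=> Hs; elim: w => //= a w; apply: cons_reduce_reduced. Qed.

Lemma reduce_reduced w : reduced (reduce w).
Proof. exact: foldr_reduced. Qed.

Lemma reduce_id w : reduced w -> reduce w = w.
Proof.
elim: w => //= a w IHw Hw; rewrite IHw; last exact: path_sorted Hw.
by case: w Hw {IHw} => [|b w] //= /andP[/negPf ->].
Qed.

Lemma cons_reduceK a s :
  reduced s -> cons_reduce a (cons_reduce (letter_inv a) s) = s.
Proof.
case: s => [|b s] /= Hs; first by rewrite eqxx.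
rewrite letter_invK; case: eqP => [eba|_] /=; last by rewrite eqxx.
by case: s Hs => [|c s] /=; rewrite eba // => /andP[/negPf ->].
Qed.

Lemma foldr_reduce s w :
  reduced s -> foldr cons_reduce s (reduce w) = foldr cons_reduce s w.
Proof.
move=> Hs; elim: w => //= a w <-.
case: (reduce w) => [|b t] //=; case: eqP => //= ->.
by rewrite cons_reduceK // foldr_reduced.
Qed.

Lemma reduce_cat u v : reduce (u ++ v) = foldr cons_reduce (reduce v) u.
Proof. exact: foldr_cat. Qed.

Lemma reduce_catl u v : reduce (reduce u ++ v) = reduce (u ++ v).
Proof. by rewrite !reduce_cat foldr_reduce ?reduce_reduced. Qed.

Lemma reduce_catr u v : reduce (u ++ reduce v) = reduce (u ++ v).
Proof. by rewrite !reduce_cat reduce_id ?reduce_reduced. Qed.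

Lemma reduce_inv w : reduce (word_inv w ++ w) = [::].
Proof.
elim: w => //= a w IHw.
rewrite /word_inv /= rev_cons cat_rcons reduce_cat /=.
by rewrite -{2}(letter_invK a) cons_reduceK ?reduce_reduced -?reduce_cat.
Qed.

Lemma word_invK : involutive word_inv.
Proof.
by move=> w; rewrite /word_inv map_rev revK (mapK letter_invK).
Qed.

Lemma word_inv_reduced w : reduced w -> reduced (word_inv w).
Proof.
rewrite /reduced /word_inv rev_sorted sorted_map; apply: sub_sorted => a b /=.
rewrite eq_sym; apply: contra => /eqP /(inv_inj letter_invK) ->.
by rewrite letter_invK.
Qed.

Record free_group := FreeGroup {
  free_word : seq (X * bool);
  _ : reduced free_word
}.

HB.instance Definition _ := [isSub for free_word].
HB.instance Definition _ := [Choice of free_group by <:].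

Implicit Types f g h : free_group.

Definition free_mul f g :=
  FreeGroup (reduce_reduced (free_word f ++ free_word g)).
Definition free_one := FreeGroup (isT : reduced [::]).
Definition free_inv f := FreeGroup (word_inv_reduced (valP f)).
Definition free_gen (x : X) := FreeGroup (isT : reduced [:: (x, false)]).

Lemma free_mulA : associative free_mul.
Proof.
by move=> f g h; apply: val_inj => /=; rewrite reduce_catl reduce_catr catA.
Qed.

Lemma free_mul1 : left_id free_one free_mul.
Proof. by move=> f; apply: val_inj; apply/reduce_id/valP. Qed.

Lemma free_mulr1 : right_id free_one free_mul.
Proof. by move=> f; apply: val_inj; rewrite /= cats0; apply/reduce_id/valP. Qed.

Lemma free_mulV : left_inverse free_one free_inv free_mul.
Proof. by move=> f; apply: val_inj; apply: reduce_inv. Qed.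

Lemma free_mulrV : right_inverse free_one free_inv free_mul.
Proof.
move=> f; apply: val_inj => /=.
by rewrite -{1}(word_invK (free_word f)) reduce_inv.
Qed.

HB.instance Definition _ := isGroup.Build free_group
  free_mulA free_mul1 free_mulr1 free_mulV free_mulrV.

End Words.

Section DerivedSeries.
Variable G : groupType.
Implicit Types A B H : set G.

Definition is_subgroup H :=
  [/\ H 1, forall x y, H x -> H y -> H (x * y) & forall x, H x -> H x^-1].

Definition is_normal H :=
  is_subgroup H /\ forall x y, H x -> H (x ^ y).

Definition generated A : set G := smallest is_subgroup A.

Definition commutator_subgroup A B :=
  generated [set z | exists a b, [/\ A a, B b & z = [~ a, b]]].

Definition derived (d : nat) : set G :=
  iter d (fun H => commutator_subgroup H H) setT.

Lemma generated_subgroup A : is_subgroup (generated A).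
Proof.
split=> [H [[]] //|x y Hx Hy H HH|x Hx H HH].
  by case: (HH) => -[_ HM _] _; apply: HM; [apply: Hx|apply: Hy].
by case: (HH) => -[_ _ HV] _; apply: HV; apply: Hx.
Qed.

Lemma derived_normal d : is_normal (derived d).
Proof.
elim: d => [|d [_ IHd]] /=; first by [].
split=> [|x y]; first exact: generated_subgroup.
move=> Hx.
pose K : set G := [set z | commutator_subgroup (derived d) (derived d) (z ^ y)].
apply: (Hx K); split.
  have [H1 HM HV] :=
    generated_subgroup [set z | exists a b,
      [/\ derived d a, derived d b & z = [~ a, b]]].
  split; rewrite /K /=; first by rewrite conj1g.
  - by move=> u v; rewrite conjMg; apply: HM.
  - by move=> u; rewrite conjVg; apply: HV.
move=> _ [a [b [Ha Hb ->]]] H [_]; apply; rewrite conjRg.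
by exists (a ^ y), (b ^ y); split=> //; apply: IHd.
Qed.

End DerivedSeries.

Section QuotientGroup.
Variables (G : groupType) (N : set G) (nN : is_normal N).

Definition eq_mod : rel G := fun x y => `[< N (x^-1 * y) >].

Let N1 : N 1. Proof. by case: nN => -[]. Qed.
Let NM x y : N x -> N y -> N (x * y). Proof. by case: nN => -[_ H _] _; apply: H. Qed.
Let NV x : N x -> N x^-1. Proof. by case: nN => -[_ _ H] _; apply: H. Qed.
Let NJ x y : N x -> N (x ^ y). Proof. by case: nN => _; apply. Qed.

Lemma eq_mod_refl : reflexive eq_mod.
Proof. by move=> x; apply/asboolP; rewrite mulVg. Qed.

Lemma eq_mod_sym : symmetric eq_mod.
Proof.
by move=> x y; apply/asboolP/asboolP => /NV; rewrite invgM invgK.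
Qed.

Lemma eq_mod_trans : transitive eq_mod.
Proof.
move=> y x z /asboolP Hxy /asboolP Hyz; apply/asboolP.
by have := NM Hxy Hyz; rewrite mulgA mulgK.
Qed.

Lemma eq_modM x x' y y' : eq_mod x x' -> eq_mod y y' -> eq_mod (x * y) (x' * y').
Proof.
move=> /asboolP Hx /asboolP Hy; apply/asboolP.
have -> : (x * y)^-1 * (x' * y') = (x^-1 * x') ^ y * (y^-1 * y').
  by rewrite /conjg invgM !mulgA mulgK.
by apply: NM => //; apply: NJ.
Qed.

Lemma eq_modV x x' : eq_mod x x' -> eq_mod x^-1 x'^-1.
Proof.
move=> /asboolP Hx; apply/asboolP.
have -> : x^-1^-1 * x'^-1 = (x^-1 * x')^-1 ^ x^-1.
  by rewrite /conjg invgM !invgK !mulgA mulgK.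
exact/NJ/NV.
Qed.

Canonical eq_mod_equiv := EquivRel eq_mod eq_mod_refl eq_mod_sym eq_mod_trans.

Local Open Scope quotient_scope.

Definition quotient_group := {eq_quot eq_mod}.

HB.instance Definition _ := Choice.on quotient_group.
HB.instance Definition _ := EqQuotient.on quotient_group.

Definition quotient_proj (x : G) : quotient_group := \pi x.

Definition quotient_mul (X Y : quotient_group) :=
  quotient_proj (repr X * repr Y).
Definition quotient_inv (X : quotient_group) := quotient_proj (repr X)^-1.

Lemma quotient_projP x y :
  quotient_proj x = quotient_proj y <-> N (x^-1 * y).
Proof.
by split=> [/eqmodP/asboolP|Hxy] //; apply/eqmodP/asboolP.
Qed.

Lemma quotient_surj X : exists x, X = quotient_proj x.
Proof. by exists (repr X); rewrite /quotient_proj reprK. Qed.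

Lemma eq_mod_repr x : eq_mod (repr (quotient_proj x)) x.
Proof. by apply/asboolP/quotient_projP; rewrite /quotient_proj reprK. Qed.

Lemma quotient_projM x y :
  quotient_mul (quotient_proj x) (quotient_proj y) = quotient_proj (x * y).
Proof. by apply/eqmodP; apply: eq_modM; apply: eq_mod_repr. Qed.

Lemma quotient_projV x :
  quotient_inv (quotient_proj x) = quotient_proj x^-1.
Proof. by apply/eqmodP; apply: eq_modV; apply: eq_mod_repr. Qed.

Lemma quotient_mulA : associative quotient_mul.
Proof.
move=> X Y Z; have [x ->] := quotient_surj X; have [y ->] := quotient_surj Y.
by have [z ->] := quotient_surj Z; rewrite !quotient_projM mulgA.
Qed.

Lemma quotient_mul1 : left_id (quotient_proj 1) quotient_mul.
Proof. by move=> X; have [x ->] := quotient_surj X; rewrite quotient_projM mul1g. Qed.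

Lemma quotient_mulr1 : right_id (quotient_proj 1) quotient_mul.
Proof. by move=> X; have [x ->] := quotient_surj X; rewrite quotient_projM mulg1. Qed.

Lemma quotient_mulV : left_inverse (quotient_proj 1) quotient_inv quotient_mul.
Proof.
move=> X; have [x ->] := quotient_surj X.
by rewrite quotient_projV quotient_projM mulVg.
Qed.

Lemma quotient_mulrV : right_inverse (quotient_proj 1) quotient_inv quotient_mul.
Proof.
move=> X; have [x ->] := quotient_surj X.
by rewrite quotient_projV quotient_projM mulgV.
Qed.

HB.instance Definition _ := isGroup.Build quotient_group
  quotient_mulA quotient_mul1 quotient_mulr1 quotient_mulV quotient_mulrV.

End QuotientGroup.

(* The default value 0 is only taken when the minimum (maximum) does not
   exist. *)
Definition nat_min (A : set nat) : nat :=
  xget 0%N [set m | A m /\ forall k, A k -> (m <= k)%N].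

Definition nat_max (A : set nat) : nat :=
  xget 0%N [set m | A m /\ forall k, A k -> (k <= m)%N].

Lemma nat_minP (A : set nat) : A !=set0 ->
  A (nat_min A) /\ forall k, A k -> (nat_min A <= k)%N.
Proof.
move=> [k Ak]; rewrite /nat_min.
apply: (@xgetPex _ 0%N [set m | A m /\ forall j, A j -> (m <= j)%N]).
have exA : exists k, `[< A k >] by exists k; apply/asboolP.
case: (ex_minnP exA) => m /asboolP Am minm; exists m; split=> // j Aj.
by apply: minm; apply/asboolP.
Qed.

Lemma nat_maxP (A : set nat) b : A !=set0 -> (forall k, A k -> (k <= b)%N) ->
  A (nat_max A) /\ forall k, A k -> (k <= nat_max A)%N.
Proof.
move=> [k Ak] Ab; rewrite /nat_max.
apply: (@xgetPex _ 0%N [set m | A m /\ forall j, A j -> (j <= m)%N]).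
have exA : exists k, `[< A k >] by exists k; apply/asboolP.
have bA i : `[< A i >] -> (i <= b)%N by move=> /asboolP/Ab.
case: (ex_maxnP exA bA) => m /asboolP Am maxm; exists m; split=> // j Aj.
by apply: maxm; apply/asboolP.
Qed.

Section ConjugacyLength.
Variables (G : groupType) (I : finType) (x : I -> G).

Definition letter_eval (a : I * bool) : G :=
  if a.2 then (x a.1)^-1 else x a.1.

Definition word_eval (w : seq (I * bool)) : G := \prod_(a <- w) letter_eval a.

Definition generates := forall g : G, exists w, word_eval w = g.

Definition word_length (g : G) : nat :=
  nat_min [set size w | w in [set w | word_eval w = g]].

Definition conjugate (u v : G) := exists w : G, w * u = v * w.

Definition min_conjugator (u v : G) : nat :=
  nat_min [set word_length w | w in [set w | w * u = v * w]].

Definition CLF_set (n : nat) : set nat :=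
  [set l | exists u v, [/\ (word_length u + word_length v <= n)%N,
                           conjugate u v & l = min_conjugator u v]].

Definition CLF (n : nat) : nat := nat_max (CLF_set n).

Hypothesis gen : generates.

Lemma word_lengthP g :
  (exists2 w, word_eval w = g & size w = word_length g) /\
  forall w, word_eval w = g -> (word_length g <= size w)%N.
Proof.
have [w0 w0g] := gen g.
have [|[w wg sw] min] :=
    @nat_minP [set size w | w in [set w | word_eval w = g]].
  by exists (size w0), w0.
by split=> [|w' w'g]; [exists w | apply: min; exists w'].
Qed.

Lemma min_conjugatorP u v : conjugate u v ->
  (exists2 w, w * u = v * w & word_length w = min_conjugator u v) /\
  forall w, w * u = v * w -> (min_conjugator u v <= word_length w)%N.
Proof.
move=> [w0 w0P].
have [|[w wP lw] min] :=
    @nat_minP [set word_length w | w in [set w | w * u = v * w]].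
  by exists (word_length w0), w0.
by split=> [|w' w'P]; [exists w | apply: min; exists w'].
Qed.

Lemma CLFP n :
  CLF_set n (CLF n) /\ forall l, CLF_set n l -> (l <= CLF n)%N.
Proof.
pose B := \max_(p : (n.-bseq (I * bool)) * (n.-bseq (I * bool)))
  min_conjugator (word_eval p.1) (word_eval p.2).
apply: (@nat_maxP _ B).
  exists (min_conjugator 1 1), 1, 1; split=> //; last first.
    by exists 1.
  have [_ min1] := word_lengthP 1; have := min1 [::].
  by rewrite /word_eval big_nil leqn0 => /(_ erefl)/eqP ->.
move=> l [u [v [luv _ ->]]].
have [[wu eu su] _] := word_lengthP u.
have [[wv ev sv] _] := word_lengthP v.
have Hu : (size wu <= n)%N by rewrite su; apply: leq_trans luv; rewrite leq_addr.
have Hv : (size wv <= n)%N by rewrite sv; apply: leq_trans luv; rewrite leq_addl.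
pose F (p : (n.-bseq (I * bool)) * (n.-bseq (I * bool))) :=
  min_conjugator (word_eval p.1) (word_eval p.2).
rewrite -eu -ev; exact: (@leq_bigmax _ F (Bseq Hu, Bseq Hv)).
Qed.

End ConjugacyLength.

Definition free_solvable (r d : nat) :=
  quotient_group (derived_normal (free_group 'I_r) d).

HB.instance Definition _ r d := Group.on (free_solvable r d).

Definition free_solvable_gen (r d : nat) (i : 'I_r) : free_solvable r d :=
  quotient_proj (derived_normal (free_group 'I_r) d) (free_gen i).

Lemma free_solvable_generates r d : generates (@free_solvable_gen r d).
Proof.
move=> g; have [f ->] := quotient_surj g; exists (free_word f).
case: f => w /= Hw.
have -> : FreeGroup Hw = \prod_(a <- w) letter_eval (@free_gen 'I_r) a.
  apply: val_inj; rewrite /= -[LHS](reduce_id Hw).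
  elim: w {Hw} => [|a w IHw]; first by rewrite big_nil.
  rewrite big_cons /= IHw.
  set f := \prod_(b <- w) _.
  rewrite -[in LHS](reduce_id (valP f)) /letter_eval.
  by case: a => i [].
elim: w {Hw} => [|a w IHw]; rewrite /word_eval ?big_nil ?big_cons //.
rewrite [X in _ * X]IHw -quotient_projM; congr (_ * _).
rewrite /letter_eval; case: a.2 => //.
by rewrite -quotient_projV.
Qed.

(* Main.v *)
(* Let G = F/N with N = F^(d-1), and S = F/[N,N]. By Magnus, an element of S is
   determined by the flow in the Cayley graph of G of the path of any word
   representing it. This gives k <= |v^k| for v <> 1 in S, by induction on the
   derived length: if v dies in G then its flow is nonzero and gets multiplied
   by k, and otherwise one projects to G.
   Let w conjugate u to v and n = |u| + |v|. If v is nontrivial in G, then the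
   images in G of the paths of v and of w u w^-1 meet modulo <v>, since a height
   function h with h(v g) = h(g) + 1 increases by 1 along the former. So after
   multiplication by a power of v the image of w in G has length at most n. The
   flow f of w satisfies f - v.f = flow(v) - w.flow(u); hence it is a partial
   sum of translates by v^j of the right-hand side, and as <v> is undistorted
   only 4n values of j contribute. All these edges are visited by a walk of
   quadratic length, into which they are spliced as in Euler's theorem. The
   resulting conjugator has length at most 36 n^2. *)
Require Import Defs.
From mathcomp Require Import all_boot all_order all_algebra.
From mathcomp Require Import reals boolp classical_sets zify ring.
Import Order.TTheory GRing.Theory Num.Theory.

Set Implicit Arguments.
Unset Strict Implicit.
Unset Printing Implicit Defensive.

Local Open Scope classical_set_scope.
Local Open Scope group_scope.

(** * Walks, edges and flows in the Cayley graph *)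

Section CayleyGraph.
Variables (G : groupType) (I : finType) (x : I -> G).
Implicit Types (g h : G) (v w : seq (I * bool)).

Local Notation ev := (word_eval x).

Lemma word_eval_nil : ev [::] = 1.
Proof. exact: big_nil. Qed.

Lemma word_eval_cons a w : ev (a :: w) = letter_eval x a * ev w.
Proof. exact: big_cons. Qed.

Lemma word_eval_cat v w : ev (v ++ w) = ev v * ev w.
Proof. exact: big_cat. Qed.

Lemma letter_eval_inv (a : I * bool) :
  letter_eval x (letter_inv a) = (letter_eval x a)^-1.
Proof. by case: a => i []; rewrite /letter_eval //= invgK. Qed.

Lemma word_inv_cons (a : I * bool) w :
  word_inv (a :: w) = word_inv w ++ [:: letter_inv a].
Proof. by rewrite /word_inv /= rev_cons cats1. Qed.

Lemma word_eval_inv w : ev (word_inv w) = (ev w)^-1.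
Proof.
elim: w => [|a w IH]; first by rewrite /= word_eval_nil invg1.
rewrite word_inv_cons word_eval_cat IH !word_eval_cons word_eval_nil mulg1.
by rewrite letter_eval_inv invgM.
Qed.

Lemma size_word_inv w : size (word_inv w) = size w.
Proof. by rewrite size_rev size_map. Qed.

Definition word_pow w n := flatten (nseq n w).

Lemma word_eval_pow w n : ev (word_pow w n) = ev w ^+ n.
Proof.
elim: n => [|n IH]; first by rewrite /word_pow /= word_eval_nil.
by rewrite [word_pow _ _]/= word_eval_cat IH expgS.
Qed.

Lemma size_word_pow w n : size (word_pow w n) = (n * size w)%N.
Proof. by elim: n => //= n IH; rewrite size_cat IH mulSn. Qed.

(* The edge [(g, a)] of the Cayley graph runs from [g] to [g * a]. *)
Definition edge := (G * (I * bool))%type.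
Implicit Types (e : edge) (c : seq edge).

Definition edge_end e : G := e.1 * letter_eval x e.2.

Definition edge_inv e : edge := (edge_end e, letter_inv e.2).

Definition edge_shift g e : edge := (g * e.1, e.2).

Fixpoint trail g w : seq edge :=
  if w is a :: w' then (g, a) :: trail (g * letter_eval x a) w' else [::].

Definition flow c e : int :=
  ((count_mem e c)%:Z - (count_mem (edge_inv e) c)%:Z)%R.

Definition visits g w h := exists p q, w = p ++ q /\ h = g * ev p.

Lemma edge_invK : involutive edge_inv.
Proof.
case=> g a; rewrite /edge_inv /edge_end [_.2]/= [_.1]/=.
by rewrite letter_invK letter_eval_inv mulgK.
Qed.

Lemma edge_end_inv e : edge_end (edge_inv e) = e.1.
Proof. by rewrite -[in RHS](edge_invK e). Qed.

Lemma edge_inv_neq e : (edge_inv e == e) = false.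
Proof.
apply/negP => /eqP; case: e => g [i b] /= [_].
by case: b.
Qed.

Lemma edge_shiftM g h e : edge_shift (g * h) e = edge_shift g (edge_shift h e).
Proof. by rewrite /edge_shift /= mulgA. Qed.

Lemma edge_shift1 e : edge_shift 1 e = e.
Proof. by case: e => g a; rewrite /edge_shift /= mul1g. Qed.

Lemma edge_shiftK g : cancel (edge_shift g) (edge_shift g^-1).
Proof. by move=> e; rewrite -edge_shiftM mulVg edge_shift1. Qed.

Lemma edge_shiftKV g : cancel (edge_shift g^-1) (edge_shift g).
Proof. by move=> e; rewrite -edge_shiftM mulgV edge_shift1. Qed.

Lemma edge_shift_inv g e :
  edge_shift g (edge_inv e) = edge_inv (edge_shift g e).
Proof. by rewrite /edge_shift /edge_inv /edge_end /= mulgA. Qed.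

Lemma edge_shift_end g e : edge_end (edge_shift g e) = g * edge_end e.
Proof. by rewrite /edge_shift /edge_end /= mulgA. Qed.

Lemma trail_cat g v w : trail g (v ++ w) = trail g v ++ trail (g * ev v) w.
Proof.
elim: v g => [|a v IH] g /=; first by rewrite word_eval_nil mulg1.
by rewrite IH word_eval_cons mulgA.
Qed.

Lemma trail_shift h g w : trail (h * g) w = map (edge_shift h) (trail g w).
Proof. by elim: w g => //= a w IH g; rewrite -mulgA IH. Qed.

Lemma trailE g w : trail g w = map (edge_shift g) (trail 1 w).
Proof. by rewrite -trail_shift mulg1. Qed.

Lemma size_trail g w : size (trail g w) = size w.
Proof. by elim: w g => //= a w IH g; rewrite IH. Qed.

Lemma trail_inv g w :
  trail (g * ev w) (word_inv w) = rev (map edge_inv (trail g w)).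
Proof.
elim: w g => [|a w IH] g; first by [].
rewrite word_inv_cons trail_cat word_eval_inv word_eval_cons mulgA mulgK IH.
by rewrite [trail g _]/= map_cons rev_cons -cats1.
Qed.

Lemma trail_visits g w e :
  e \in trail g w -> visits g w e.1 /\ visits g w (edge_end e).
Proof.
elim: w g => //= a w IH g; rewrite inE => /orP[/eqP->|/IH[[p [q [-> ->]]]]].
  split; first by exists [::], (a :: w); rewrite word_eval_nil mulg1.
  by exists [:: a], w; rewrite word_eval_cons word_eval_nil mulg1.
move=> [p' [q' [E ->]]]; split.
  by exists (a :: p), q; rewrite word_eval_cons mulgA.
by exists (a :: p'), q'; rewrite word_eval_cons mulgA E.
Qed.

Lemma visits_size g w h : visits g w h ->
  exists2 p, h = g * ev p & (size p <= size w)%N.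
Proof.
by move=> [p [q [-> ->]]]; exists p => //; rewrite size_cat leq_addr.
Qed.

Lemma visits_cons g a w h :
  visits g (a :: w) h <-> h = g \/ visits (g * letter_eval x a) w h.
Proof.
split=> [[[|b p] [q [] ]]|[->|[p [q [-> ->]]]]].
- by move=> _ ->; left; rewrite word_eval_nil mulg1.
- by move=> [<- ->] ->; right; exists p, q; rewrite word_eval_cons mulgA.
- by exists [::], (a :: w); rewrite word_eval_nil mulg1.
- by exists (a :: p), q; rewrite word_eval_cons mulgA.
Qed.

Lemma visits_catl g v w h : visits g v h -> visits g (v ++ w) h.
Proof. by move=> [p [q [-> ->]]]; exists p, (q ++ w); rewrite catA. Qed.

Lemma visits_catr g v w h : visits (g * ev v) w h -> visits g (v ++ w) h.
Proof.
move=> [p [q [-> ->]]]; exists (v ++ p), q.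
by rewrite catA word_eval_cat mulgA.
Qed.

Lemma visits_cat g v w h :
  visits g (v ++ w) h -> visits g v h \/ visits (g * ev v) w h.
Proof.
elim: v g => [|a v IH] g; first by rewrite word_eval_nil mulg1; right.
rewrite word_eval_cons mulgA => /visits_cons[->|/IH[H|H]].
- by left; apply/visits_cons; left.
- by left; apply/visits_cons; right.
- by right.
Qed.

Lemma visits_shift g h w k : visits h w k -> visits (g * h) w (g * k).
Proof. by move=> [p [q [-> ->]]]; exists p, q; rewrite mulgA. Qed.

Lemma flow_cat c1 c2 e : flow (c1 ++ c2) e = (flow c1 e + flow c2 e)%R.
Proof. by rewrite /flow !count_cat; lia. Qed.

Lemma flow_perm c1 c2 : perm_eq c1 c2 -> flow c1 =1 flow c2.
Proof. by move=> /permP P e; rewrite /flow !P. Qed.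

Lemma flow_inv c e : flow (map edge_inv c) e = (- flow c e)%R.
Proof.
have H f : count_mem f (map edge_inv c) = count_mem (edge_inv f) c.
  rewrite count_map; apply: eq_count => f' /=.
  by rewrite (can2_eq edge_invK edge_invK).
by rewrite /flow !H edge_invK; lia.
Qed.

Lemma flow_edge_inv c e : flow c (edge_inv e) = (- flow c e)%R.
Proof. by rewrite /flow edge_invK; lia. Qed.

Lemma flow_shift g c e :
  flow (map (edge_shift g) c) e = flow c (edge_shift g^-1 e).
Proof.
have H f : count_mem f (map (edge_shift g) c) = count_mem (edge_shift g^-1 f) c.
  rewrite count_map; apply: eq_count => f' /=.
  by rewrite (can2_eq (edge_shiftK g) (edge_shiftKV g)).
by rewrite /flow !H edge_shift_inv.
Qed.

Lemma flow_trail g w e :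
  flow (trail g w) e = flow (trail 1 w) (edge_shift g^-1 e).
Proof. by rewrite trailE flow_shift. Qed.

Lemma flow_trail_inv g w e :
  flow (trail (g * ev w) (word_inv w)) e = (- flow (trail g w) e)%R.
Proof.
rewrite trail_inv -flow_inv; apply: flow_perm.
by rewrite perm_rev.
Qed.

Lemma flow_neq0 c e : flow c e <> 0%R -> e \in c \/ edge_inv e \in c.
Proof.
move=> H; case: (boolP (e \in c)) => [|/count_memPn H1]; first by left.
right; apply/negPn/negP => /count_memPn H2; apply: H.
by rewrite /flow H1 H2.
Qed.

Lemma flow_trail_visits g w e : flow (trail g w) e <> 0%R -> visits g w e.1.
Proof.
case/flow_neq0 => /trail_visits[] //.
by rewrite edge_end_inv.
Qed.

Lemma flow_bound c e : (`|flow c e| <= size c)%N.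
Proof.
rewrite /flow; have := count_size (pred1 (edge_inv e)) c.
have := count_size (pred1 e) c.
by move: (count _ _) (count _ _) (size c) => m n k; lia.
Qed.

(** As [edge_inv e] differs from [e], a head [e] can only be balanced by an [edge_inv e] in the
    tail; deleting the pair keeps the flow zero. *)
Lemma zero_flow_ind (P : seq edge -> Prop) :
    P [::] ->
    (forall e c1 c2, P (c1 ++ c2) -> P (e :: c1 ++ edge_inv e :: c2)) ->
  forall c, (forall e, flow c e = 0%R) -> P c.
Proof.
move=> P0 Pstep c; have [n] := ubnP (size c).
elim: n c => // n IH [|e c] //= szc c0.
have ec : edge_inv e \in c.
  have := c0 e; rewrite /flow /= eqxx [e == _]eq_sym edge_inv_neq.
  rewrite -has_pred1 has_count.
  by move: (count_mem e c) (count_mem (edge_inv e) c) => m k; lia.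
case/splitPr: ec szc c0 => c1 c2 szc c0.
apply: Pstep; apply: IH => [|f].
  by move: szc; rewrite !size_cat /=; lia.
have := c0 f; rewrite -[e :: _]/([:: e] ++ (c1 ++ ([:: edge_inv e] ++ c2))).
rewrite !flow_cat.
have -> : flow [:: edge_inv e] f = (- flow [:: e] f)%R.
  by rewrite -flow_inv.
by lia.
Qed.

(** Antisymmetric weights cancel on opposite edges, so [zero_flow_ind] applies to [c1] followed by
    the inverses of [c2]. *)
Lemma eq_flow_sum (theta : edge -> int) c1 c2 :
    (forall e, theta (edge_inv e) = (- theta e)%R) ->
    flow c1 =1 flow c2 ->
  (\sum_(e <- c1) theta e = \sum_(e <- c2) theta e)%R.
Proof.
move=> thetaN E12.
suff : (\sum_(e <- c1 ++ map edge_inv c2) theta e = 0)%R.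
  rewrite big_cat big_map /=.
  rewrite [X in (_ + X)%R](eq_bigr (fun e => - theta e)%R) //= sumrN.
  by move/eqP; rewrite subr_eq0 => /eqP.
apply: (@zero_flow_ind (fun c => \sum_(e <- c) theta e = 0)%R).
- by rewrite big_nil.
- by move=> e c c'; rewrite big_cons !big_cat big_cons thetaN /= => H; lia.
- by move=> e; rewrite flow_cat flow_inv E12 subrr.
Qed.

Lemma trail_sum (tau : G -> int) g w :
  (\sum_(e <- trail g w) (tau (edge_end e) - tau e.1) =
   tau (g * ev w)%g - tau g)%R.
Proof.
elim: w g => [|a w IH] g /=.
  by rewrite big_nil word_eval_nil mulg1 subrr.
by rewrite big_cons IH word_eval_cons mulgA /edge_end /= addrC addrA subrK.
Qed.

(** A flow determines its boundary: the weight is the coboundary of the indicator function of [z],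
    whose sum telescopes. *)
Lemma eq_flow_end g v h w : flow (trail g v) =1 flow (trail h w) ->
  forall z : G, (((g * ev v)%g == z)%:Z - (g == z)%:Z =
   ((h * ev w)%g == z)%:Z - (h == z)%:Z)%R.
Proof.
move=> E z; rewrite -!(trail_sum (fun y => (y == z)%:Z%R)).
by apply: eq_flow_sum => // e /=; rewrite edge_end_inv; lia.
Qed.

(* An Euler walk: the edges of [c], which together lead from the end [g] of
   the first half [v] to the beginning [h] of the second half [w], are spliced
   one at a time into the broken walk [(v, w)]; when no edge of [c] leaves the
   gap, the gap is closed and can be moved to any other visited vertex. *)
Lemma euler_walk c g v h w :
    (forall e, e \in c -> visits 1 v e.1 \/ visits h w e.1) ->
    g = ev v ->
    (forall z, \sum_(e <- c) ((edge_end e == z)%:Z - (e.1 == z)%:Z) =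
               (h == z)%:Z - (g == z)%:Z)%R ->
  exists2 s, size s = (size v + size w + size c)%N &
    ev s = h * ev w /\ forall e,
    (flow (trail 1 s) e = flow (trail 1 v) e + flow c e + flow (trail h w) e)%R.
Proof.
have [n] := ubnP (size c); elim: n c g v h w => // n IH c g v h w szc.
have step c1 c2 a v' h' w' : (size (c1 ++ (ev v', a) :: c2) < n.+1)%N ->
    (forall e, e \in c1 ++ (ev v', a) :: c2 ->
       visits 1 v' e.1 \/ visits h' w' e.1) ->
    (forall z, \sum_(e <- c1 ++ (ev v', a) :: c2)
        ((edge_end e == z)%:Z - (e.1 == z)%:Z) =
        (h' == z)%:Z - (ev v' == z)%:Z)%R ->
    exists2 s, size s = (size v' + size w' + size (c1 ++ (ev v', a) :: c2))%N &
    ev s = h' * ev w' /\ forall e,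
    (flow (trail 1 s) e =
     flow (trail 1 v') e + flow (c1 ++ (ev v', a) :: c2) e
     + flow (trail h' w') e)%R.
  move=> szc' vis bd.
  have [||||s sz_s [evs fl]] :=
      IH (c1 ++ c2) (ev (v' ++ [:: a])) (v' ++ [:: a]) h' w'.
  - by move: szc'; rewrite !size_cat /=; lia.
  - move=> e ec; have /vis[] : e \in c1 ++ (ev v', a) :: c2.
    + by move: ec; rewrite !mem_cat inE => /orP[->|->]; rewrite ?orbT.
    + by left; apply: visits_catl.
    + by right.
  - by [].
  - move=> z; have := bd z; rewrite !big_cat big_cons /= /edge_end /=.
    rewrite word_eval_cat word_eval_cons word_eval_nil mulg1.
    by lia.
  exists s; first by rewrite sz_s !size_cat /=; lia.
  split=> // e; rewrite fl trail_cat mul1g /= -[_ :: c2]cat1s !flow_cat.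
  by ring.
move=> vis -> bd.
have [[a ac]|none] := pselect (exists a, (ev v, a) \in c).
  by case/splitPr: ac szc vis bd => c1 c2; apply: step.
have out0 : (\sum_(e <- c) (e.1 == ev v)%:Z = 0)%R.
  rewrite big_seq big1 // => -[k a] ec /=.
  by case: eqP => // E; case: none; exists a; rewrite -E.
(* At [z = ev v] the left side of [bd] has no negative part, while the right side is
   [(h == ev v) - 1]. *)
have /eqP hv : h == ev v.
  have := bd (ev v); rewrite big_split /= sumrN out0 eqxx.
  have : (0 <= \sum_(e <- c) (edge_end e == ev v)%:Z)%R.
    by apply: sumr_ge0 => e _.
  by move: (\sum_(e <- c) _)%R => S; case: (h == ev v) => //=; lia.
subst h; have vw1 : forall k, visits 1 v k \/ visits (ev v) w k ->
    visits 1 (v ++ w) k.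
  move=> k [|H]; first exact: visits_catl.
  by apply: visits_catr; rewrite mul1g.
case: c szc vis bd {none out0} => [|[k a] c] szc vis bd.
  exists (v ++ w); first by rewrite size_cat /= addn0.
  split=> [|e]; first exact: word_eval_cat.
  by rewrite trail_cat flow_cat mul1g /flow /=; lia.
have [p [q [vwE kE]]] := vw1 _ (vis _ (mem_head _ _)).
rewrite mul1g /= in kE; subst k.
have [||s sz_s [evs fl]] := step [::] c a p (ev p) q szc.
- by move=> e /vis /vw1; rewrite vwE => /visits_cat; rewrite mul1g.
- by move=> z; have := bd z; rewrite /= !subrr.
exists s.
  by rewrite sz_s /=; move/(congr1 size): vwE; rewrite !size_cat; lia.
split; first by rewrite evs -!word_eval_cat -vwE.
move=> e; rewrite fl.
have : flow (trail 1 (v ++ w)) e = flow (trail 1 (p ++ q)) e by rewrite vwE.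
by rewrite !trail_cat !flow_cat !mul1g /=; lia.
Qed.

End CayleyGraph.

(** * Powers: their flow, their length, and heights along orbits *)

Lemma trail_pow (G : groupType) (I : finType) (x : I -> G) w n e :
  word_eval x w = 1 ->
  flow x (trail x 1 (word_pow w n)) e = (n%:Z * flow x (trail x 1 w) e)%R.
Proof.
move=> w1; elim: n => [|n IH]; first by rewrite /flow /= mul0r subrr.
rewrite [word_pow _ _]/= trail_cat flow_cat w1 mulg1 IH.
by rewrite [n.+1]lock -lock intS mulrDl mul1r.
Qed.

(** Taking [s] empty shows that nontrivial values of words have infinite order. *)
Definition undistorted (G : groupType) (I : finType) (x : I -> G) :=
  forall v s k, word_eval x v <> 1 -> word_eval x s = word_eval x v ^+ k ->
  (k <= size s)%N.


(** The height is the signed exponent of [b] relative to a chosen representative of each orbit;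
    infinite order makes it well defined. *)
Lemma orbit_height (G : groupType) (b : G) :
  (forall k, b ^+ k = 1 -> k = 0%N) ->
  exists tau : G -> int, forall g, tau (b * g)%g = (tau g + 1)%R.
Proof.
move=> binf.
pose orb g : set G := [set h | exists i j, b ^+ i * h = b ^+ j * g].
have orbb g : orb (b * g) = orb g.
  apply/seteqP; split=> h [i [j E]].
    by exists i, j.+1; rewrite E expgSr mulgA.
  by exists i.+1, j; rewrite expgS -mulgA E !mulgA -expgS expgSr.
pose rep g := xget 1 (orb g).
have repP g : orb g (rep g).
  by apply: (@xgetPex _ 1 (orb g)); exists g, 0%N, 0%N.
pose ht g : set int := [set m | exists i j,
  b ^+ i * rep g = b ^+ j * g /\ m = (i%:Z - j%:Z)%R].
have htP g : ht g (xget 0%R (ht g)).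
  apply: xgetPex; have [i [j E]] := repP g.
  by exists (i%:Z - j%:Z)%R, i, j.
have binj i j : b ^+ i = b ^+ j -> i = j.
  wlog: i j / (i <= j)%N => [H E|ij E].
    by have [/H|/ltnW/H->] := leqP i j; rewrite ?E //; apply.
  have /binf : b ^+ (j - i) = 1 by rewrite expgnFr // -E mulgV.
  by lia.
have ht_inj g m n : ht g m -> ht g n -> m = n.
  move=> [i [j [E1 ->]]] [k [l [E2 ->]]].
  have : b ^+ (l + i) * rep g = b ^+ (j + k) * rep g.
    rewrite !expgnDr -!mulgA E1 E2 !mulgA -!expgnDr addnC.
    by [].
  by move/mulIg/binj; lia.
exists (fun g => xget 0%R (ht g)) => g.
apply: (@ht_inj (b * g)); first exact: htP.
have [i [j [E m]]] := htP g; exists i.+1, j.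
rewrite m; split; last by lia.
by rewrite /rep orbb expgS -mulgA E !mulgA -expgS expgSr.
Qed.

(** * Comparing two groups through the Magnus criterion *)

Section MagnusEmbedding.
Variables (G S : groupType) (I : finType) (x : I -> G) (y : I -> S).
Implicit Types (u v w : seq (I * bool)).

Local Notation ev := (word_eval x).
Local Notation evS := (word_eval y).

Lemma eq_flow_eval g v w :
  flow x (trail x g v) =1 flow x (trail x g w) -> ev v = ev w.
Proof.
move=> /eq_flow_end/(_ (g * ev v)); rewrite eqxx.
by case: (g * ev w =P _) => [/mulgI->|_] //=; case: (g == _) => //=; lia.
Qed.

Section ZeroFlow.
Hypothesis gen : generates x.
Hypothesis comm : forall v w,
  ev v = 1 -> ev w = 1 -> evS v * evS w = evS w * evS v.

(** A transversal, from which [loop] forms Schreier generators of the kernel. Lifting [1] to the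
    empty word removes the correction factors in [evS_loops] for closed paths at [1]. *)
Let lift (g : G) : seq (I * bool) :=
  if g == 1 then [::] else projT1 (cid (gen g)).

Let ev_lift g : ev (lift g) = g.
Proof.
rewrite /lift; case: eqP => [->|_]; first exact: word_eval_nil.
by case: cid.
Qed.

Let loop (e : edge G I) := lift e.1 ++ e.2 :: word_inv (lift (edge_end x e)).

Let ev_loop e : ev (loop e) = 1.
Proof.
rewrite word_eval_cat word_eval_cons word_eval_inv !ev_lift mulgA.
exact: mulgV.
Qed.

Let evS_loop_inv e : evS (loop (edge_inv x e)) = (evS (loop e))^-1.
Proof.
rewrite !word_eval_cat !word_eval_cons !word_eval_inv edge_end_inv.
by rewrite letter_eval_inv !invgM invgK mulgA.
Qed.

Let evS_loops g w : evS (lift g) * evS w =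
  \prod_(e <- trail x g w) evS (loop e) * evS (lift (g * ev w)).
Proof.
elim: w g => [|a w IH] g /=.
  by rewrite big_nil !word_eval_nil !mulg1 mul1g.
rewrite big_cons -mulgA [ev (a :: w)]word_eval_cons [g * (_ * _)]mulgA -IH.
rewrite /loop word_eval_cat !word_eval_cons word_eval_inv /=.
by rewrite /edge_end /= !mulgA mulgVK.
Qed.

(* Writing [w] as a product of the loops of its edges, which lie in the abelian
   kernel, the loops of opposite traversals of an edge cancel. *)
Lemma zero_flow_eval w :
  (forall e, flow x (trail x 1 w) e = 0%R) -> evS w = 1.
Proof.
move=> w0; have w1 : ev w = 1.
  by rewrite -(word_eval_nil x); apply: (@eq_flow_eval 1) => e; rewrite w0.
have := evS_loops 1 w; rewrite w1 mulg1 /lift eqxx word_eval_nil mul1g mulg1.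
move=> ->; move: w0.
apply: (@zero_flow_ind _ _ x (fun c => \prod_(e <- c) evS (loop e) = 1)).
  by rewrite big_nil.
move=> e c1 c2 c0; rewrite !big_cons !big_cat big_cons /= evS_loop_inv.
rewrite mulgA [evS (loop e) * _]commute_prod => [|f _]; last first.
  by apply: comm; apply: ev_loop.
by rewrite -mulgA mulVKg -big_cat.
Qed.

End ZeroFlow.

Hypothesis magnus : forall w,
  evS w = 1 <-> forall e, flow x (trail x 1 w) e = 0%R.

(** The flow of [v ++ word_inv w] is the difference of the two flows only once the end points agree,
    which either side ensures. *)
Lemma magnus_eq v w :
  evS v = evS w <-> flow x (trail x 1 v) =1 flow x (trail x 1 w).
Proof.
have E : evS v = evS w <-> evS (v ++ word_inv w) = 1.
  rewrite word_eval_cat word_eval_inv; split=> [->|]; first exact: mulgV.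
  exact: divg1_eq.
have flE : ev v = ev w -> forall e, flow x (trail x 1 (v ++ word_inv w)) e =
    (flow x (trail x 1 v) e - flow x (trail x 1 w) e)%R.
  move=> vw e; rewrite trail_cat flow_cat vw flow_trail_inv.
  by [].
rewrite E magnus; split=> [H e|H e].
  have vw : ev v = ev w.
    apply: divg1_eq; rewrite -word_eval_inv -word_eval_cat -(word_eval_nil x).
    by apply: (@eq_flow_eval 1) => f; rewrite H.
  by have := H e; rewrite flE // => /eqP; rewrite subr_eq0 => /eqP.
by rewrite flE ?H ?subrr //; apply: eq_flow_eval H.
Qed.

Lemma undistorted_ext : undistorted x -> undistorted y.
Proof.
move=> ux v s k v1; rewrite -word_eval_pow => /magnus_eq E.
have [ev1|/eqP nev1] := eqVneq (ev v) 1; last first.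
  by apply: (ux v) => //; rewrite -word_eval_pow; apply: eq_flow_eval E.
have [e /eqP ne] : exists e, flow x (trail x 1 v) e <> 0%R.
  by apply: contrapT => H; apply: v1; apply/magnus => e;
    apply: contrapT => ne; apply: H; exists e.
(* The flow of [s] at [e] is [k] times a nonzero integer, and [size s] bounds its absolute value. *)
have := flow_bound x (trail x 1 s) e; rewrite E trail_pow // size_trail.
by apply: leq_trans; rewrite abszM leq_pmulr // absz_gt0.
Qed.

Local Notation F w := (flow x (trail x 1 w)).

(** The flow is a crossed homomorphism, like a Fox derivative. *)
Lemma conj_flow u v w : evS w * evS u = evS v * evS w <->
  forall e, (F w e + F u (edge_shift (ev w)^-1 e) =
             F v e + F w (edge_shift (ev v)^-1 e))%R.
Proof.
rewrite -!word_eval_cat magnus_eq.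
by split=> H e; have := H e; rewrite !trail_cat !flow_cat !mul1g;
  rewrite [flow _ (trail x (ev w) u) e]flow_trail
          [flow _ (trail x (ev v) w) e]flow_trail.
Qed.

(** The terms [F w] cancel in [conj_flow], so only [ev w] matters: it carries the flow of [u] to
    that of [v]. Matching one edge writes [ev w] as a prefix of [v] times an inverse prefix of
    [u]. *)
Lemma kernel_conjugator u v w : ev v = 1 -> evS w * evS u = evS v * evS w ->
  exists2 t, evS t * evS u = evS v * evS t & (size t <= size u + size v)%N.
Proof.
move=> v1 /conj_flow H.
have Hv e : (F w e + F u (edge_shift (ev w)^-1 e) = F v e + F w e)%R.
  by rewrite H v1 invg1 edge_shift1.
have [u0|] := pselect (forall e, F u e = 0%R).
  exists [::] => //; have -> : evS u = 1 by apply/magnus.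
  suff -> : evS v = 1 by rewrite mulg1 mul1g.
  by apply/magnus => e; have := Hv e; rewrite u0; lia.
move=> /asboolP; rewrite asbool_neg => /existsp_asboolPn[e ue].
have [p [p' [up ep]]] := flow_trail_visits ue.
have ve : F v (edge_shift (ev w) e) <> 0%R.
  by have := Hv (edge_shift (ev w) e); rewrite edge_shiftK; lia.
have [q [q' [vq]]] := flow_trail_visits ve.
rewrite /= ep !mul1g => eq.
have tw : ev (q ++ word_inv p) = ev w.
  by rewrite word_eval_cat word_eval_inv -eq mulgK.
exists (q ++ word_inv p).
  apply/conj_flow => f; rewrite tw v1 invg1 edge_shift1.
  by have := Hv f; lia.
by rewrite size_cat size_word_inv up vq !size_cat; lia.
Qed.

Hypothesis ux : undistorted x.

Lemma orbit_distance v p q k : ev v <> 1 -> ev q = ev v ^+ k * ev p ->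
  (k <= size p + size q)%N.
Proof.
move=> v1 E; rewrite addnC -(size_word_inv p) -size_cat; apply: (ux v1).
by rewrite word_eval_cat word_eval_inv E mulgK.
Qed.

(** Otherwise sum over [w u] and [v w] the differential of [tau], cut off to the saturation [V] of
    the path of [v] under powers of [v]. It is invariant under [v], so the [w] parts cancel; the
    path of [u] from [ev w] misses [V], and [v] contributes 1. *)
Lemma conjugator_meets u v w : ev v <> 1 -> evS w * evS u = evS v * evS w ->
  exists a b g h, [/\ visits x 1 v g, visits x 1 u h &
    ev v ^+ a * g = ev v ^+ b * (ev w * h)].
Proof.
move=> v1 E; apply: contrapT => none.
have [|tau tauP] := @orbit_height G (ev v).
  move=> k k0; have := @orbit_distance v [::] [::] k v1.
  by rewrite k0 mul1g leqn0 => /(_ erefl)/eqP.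
pose V z := `[< exists a b g,
  visits x 1 v g /\ ev v ^+ a * g = ev v ^+ b * z >].
pose theta (e : edge G I) : int := if V e.1 && V (edge_end x e)
  then (tau (edge_end x e) - tau e.1)%R else 0%R.
have Vv z : V (ev v * z) = V z.
  apply/asboolP/asboolP => -[a [b [g [vg eg]]]].
    by exists a, b.+1, g; rewrite eg expgSr mulgA.
  by exists a.+1, b, g; rewrite expgS -mulgA eg !mulgA -expgS expgSr.
have theta_inv e : theta (edge_inv x e) = (- theta e)%R.
  rewrite /theta edge_end_inv andbC.
  by case: ifP => _; rewrite ?oppr0 // opprB.
have theta_shift e : theta (edge_shift (ev v) e) = theta e.
  rewrite /theta edge_shift_end /= !Vv !tauP.
  by case: ifP => // _; lia.
have := E; rewrite -!word_eval_cat magnus_eq => /(eq_flow_sum theta_inv).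
rewrite !trail_cat !big_cat /= !mul1g (trailE _ (ev v)) big_map.
rewrite [X in (_ = _ + X)%R](eq_bigr theta) // addrC => /addIr.
rewrite big_seq big1 => [|e eu]; last first.
  rewrite /theta; case: ifP => // /andP[/asboolP[a [b [g [vg eg]]]] _].
  case: none; have [[p [q [up ep]]] _] := trail_visits eu.
  exists a, b, g, (ev p); split=> //; last by rewrite eg ep.
  by exists p, q; rewrite mul1g.
rewrite big_seq (eq_bigr (fun e => tau (edge_end x e) - tau e.1)%R).
  rewrite -big_seq trail_sum mul1g.
  by have := tauP 1; rewrite mulg1 => ->; lia.
move=> e /trail_visits[e1 e2]; rewrite /theta ifT //.
apply/andP; split; apply/asboolP; exists 0%N, 0%N.
  by exists e.1; rewrite !mul1g.
by exists (edge_end x e); rewrite !mul1g.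
Qed.

Lemma conjugator_over_short u v w :
  ev v <> 1 -> evS w * evS u = evS v * evS w ->
  exists w' t, [/\ evS w' * evS u = evS v * evS w', ev w' = ev t &
    (size t <= size u + size v)%N].
Proof.
move=> v1 E; have [a [b [g [h [vg uh E2]]]]] := conjugator_meets v1 E.
have [p gp sp] := visits_size vg; have [q hq sq] := visits_size uh.
move: E2; rewrite gp hq !mul1g => E2.
(* Powers of [v] commute with [v], so the first word still conjugates; the meeting point gives it
   the value of the second. *)
exists (word_inv (word_pow v a) ++ word_pow v b ++ w), (p ++ word_inv q).
split; last by rewrite size_cat size_word_inv addnC leq_add.
  rewrite !word_eval_cat word_eval_inv !word_eval_pow.
  have C k : commute (evS v) (evS v ^+ k) by apply: commuteX.
  rewrite -!mulgA E !mulgA; congr (_ * _).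
  rewrite (commuteV (C a)) -!mulgA; congr (_ * _).
  by rewrite -C.
rewrite !word_eval_cat !word_eval_inv !word_eval_pow.
apply: (mulIg (ev q)); rewrite mulgVK.
by rewrite -!mulgA -E2 mulKg.
Qed.

(** * Rebuilding the conjugator as a short walk *)

Section ShortConjugator.
Variables u v w t : seq (I * bool).
Hypotheses (v1 : ev v <> 1) (wP : evS w * evS u = evS v * evS w).
Hypotheses (wt : ev w = ev t) (szt : (size t <= size u + size v)%N).

Let n := (size u + size v)%N.

(** Its flow is that of [v] minus that of [u] translated by [ev w = ev t]. So [F_rec] is
    [conj_flow], and iterating it telescopes to [flow_chain]. *)
Let c0 := trail x 1 v ++ map (edge_inv x) (trail x (ev t) u).

Fixpoint chain M : seq (edge G I) :=
  if M is M'.+1 then chain M' ++ map (edge_shift (ev v ^+ M')) c0 else [::].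

Let F_rec e : F w e = (flow x c0 e + F w (edge_shift (ev v)^-1 e))%R.
Proof.
have := (conj_flow u v w).1 wP e.
rewrite /c0 flow_cat flow_inv (flow_trail _ (ev t)) wt.
by move/(canRL (addrK _)) ->; ring.
Qed.

Let flow_chain M e :
  flow x (chain M) e = (F w e - F w (edge_shift (ev v ^+ M)^-1 e))%R.
Proof.
elim: M => [|M IH] /=; first by rewrite invg1 edge_shift1 subrr.
rewrite flow_cat IH flow_shift (F_rec (edge_shift (ev v ^+ M)^-1 e)).
rewrite -edge_shiftM -invgM -expgSr.
by ring.
Qed.

(** Only qualitative, as [size w] is not controlled: it makes [F w] vanish far out along the orbits
    of [v]. *)
Let F_far e M : F w e <> 0%R -> F w (edge_shift (ev v ^+ M) e) <> 0%R ->
  (M <= 2 * size w)%N.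
Proof.
move=> /flow_trail_visits/visits_size[p ep sp].
move=> /flow_trail_visits/visits_size[q eq sq].
apply: leq_trans (orbit_distance v1 (p := p) (q := q) _) _; last by lia.
by move: ep eq; rewrite /= !mul1g => -> ->.
Qed.

Let c0_short e : e \in c0 -> exists2 p, e.1 = ev p & (size p <= 2 * n)%N.
Proof.
have ut h : visits x (ev t) u h -> exists2 p, h = ev p & (size p <= 2 * n)%N.
  move=> /visits_size[p -> sp]; exists (t ++ p); first by rewrite word_eval_cat.
  by rewrite size_cat /n; lia.
rewrite mem_cat => /orP[/trail_visits[/visits_size[p ep sp] _]|].
  by exists p; [rewrite ep mul1g | rewrite /n; lia].
by case/mapP => f /trail_visits[_ /ut fu] ->.
Qed.

Let c0_flow_short e : flow x c0 e <> 0%R ->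
  exists2 p, e.1 = ev p & (size p <= 2 * n)%N.
Proof.
have uv f : f \in c0 -> exists2 p, edge_end x f = ev p & (size p <= 2 * n)%N.
  rewrite mem_cat => /orP[/trail_visits[_ /visits_size[p ep sp]]|].
    by exists p; [rewrite ep mul1g | rewrite /n; lia].
  case/mapP => g /trail_visits[/visits_size[p ep sp] _] ->.
  exists (t ++ p); first by rewrite edge_end_inv ep word_eval_cat.
  by rewrite size_cat /n; lia.
case/flow_neq0 => [/c0_short //|/uv].
by rewrite edge_end_inv.
Qed.

(** Without flow of [c0] on this ray, [F_rec] would make [F w] constant along it, against [F_far].
    [F_above] argues likewise in the other direction. *)
Let F_below e : F w e <> 0%R ->
  exists j, flow x c0 (edge_shift (ev v ^+ j)^-1 e) <> 0%R.
Proof.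
move=> we; apply: contrapT => none.
have const M : F w (edge_shift (ev v ^+ M)^-1 e) = F w e.
  elim: M => [|M IH]; first by rewrite invg1 edge_shift1.
  rewrite -IH [RHS]F_rec -edge_shiftM -invgM -expgSr.
  suff -> : flow x c0 (edge_shift (ev v ^+ M)^-1 e) = 0%R by rewrite add0r.
  by apply: contrapT => ne; apply: none; exists M.
have := @F_far (edge_shift (ev v ^+ (2 * size w).+1)^-1 e) (2 * size w).+1.
by rewrite edge_shiftKV const ltnn => /(_ we we).
Qed.

Let F_above e : F w e <> 0%R ->
  exists j, flow x c0 (edge_shift (ev v ^+ j.+1) e) <> 0%R.
Proof.
move=> we; apply: contrapT => none.
have const M : F w (edge_shift (ev v ^+ M) e) = F w e.
  elim: M => [|M IH]; first by rewrite edge_shift1.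
  rewrite -IH F_rec -edge_shiftM [in X in (_ + X)%R]expgS mulKg.
  suff -> : flow x c0 (edge_shift (ev v ^+ M.+1) e) = 0%R by rewrite add0r.
  by apply: contrapT => ne; apply: none; exists M.
have := @F_far e (2 * size w).+1.
by rewrite const ltnn => /(_ we we).
Qed.

Let F_narrow e : F w e <> 0%R ->
  F w (edge_shift (ev v ^+ (4 * n))^-1 e) = 0%R.
Proof.
move=> we; apply: contrapT => we'.
have [j /c0_flow_short[p ep sp]] := F_below we'.
have [k /c0_flow_short[q eq sq]] := F_above we.
(* Both vertices lie within [2 * n] of [1], so at most [4 * n] powers of [v] separate them; the
   extra one in [k.+1] gives the contradiction. *)
have : (k.+1 + 4 * n + j <= size p + size q)%N; last by lia.
apply: (orbit_distance v1); rewrite -eq -ep /= expgnDr [_ ^+ (_.+1 + _)]expgnDr.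
by rewrite !mulgA !mulgK.
Qed.

(** The filter removes the leftover translate of [F w] in [flow_chain]: by [F_narrow] it vanishes
    wherever [F w] does not. *)
Let support := [seq e <- chain (4 * n) | F w e != 0%R].

Let flow_support e : flow x support e = F w e.
Proof.
have -> : flow x support e = if F w e != 0%R then flow x (chain (4 * n)) e
                             else 0%R.
  have cnt f : count_mem f support =
      if F w f != 0%R then count_mem f (chain (4 * n)) else 0%N.
    rewrite count_filter; case: ifP => H; last first.
      rewrite (eq_count (a2 := pred0)) ?count_pred0 // => g /=.
      by case: eqP => // ->; rewrite H.
    by apply: eq_count => g /=; case: eqP => // ->; rewrite H.
  rewrite /flow !cnt flow_edge_inv oppr_eq0.
  by case: ifP.
case: ifP => [/eqP we|/negbFE/eqP//].
by rewrite flow_chain F_narrow // subr0.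
Qed.

Let size_chain M : size (chain M) = (M * n)%N.
Proof.
elim: M => //= M IH; rewrite size_cat IH size_map size_cat size_map !size_trail.
by rewrite /n; lia.
Qed.

(** A detour along [t u] and back, then [v]: it meets the start of every edge of [c0] and ends at
    [ev v], so its repetitions follow the translates in [chain]. *)
Let block := t ++ u ++ word_inv u ++ word_inv t ++ v.

Let ev_block : ev block = ev v.
Proof. by rewrite !word_eval_cat !word_eval_inv !mulVKg. Qed.

Let c0_visits e : e \in c0 -> visits x 1 block e.1.
Proof.
have ut h : visits x (ev t) u h -> visits x 1 block h.
  by move=> H; apply/visits_catr; rewrite mul1g; apply/visits_catl.
rewrite mem_cat => /orP[/trail_visits[ev1 _]|].
  rewrite /block !catA; apply: visits_catr.
  by rewrite !word_eval_cat !word_eval_inv mul1g mulgK mulgV.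
by case/mapP => f /trail_visits[_ /ut fu] ->.
Qed.

Let pow_visits M j h : (j < M)%N -> visits x 1 block h ->
  visits x 1 (word_pow block M) (ev v ^+ j * h).
Proof.
elim: M j => // M IH [|j] jM hb; first by rewrite mul1g; apply: visits_catl.
apply: visits_catr; rewrite mul1g ev_block expgS -mulgA.
by have := visits_shift (ev v) (IH j jM hb); rewrite mulg1.
Qed.

Let chain_visits M e : e \in chain M -> visits x 1 (word_pow block M) e.1.
Proof.
move=> eM; have [j jM [f fc ->]] :
    exists2 j, (j < M)%N & exists2 f, f \in c0 & e = edge_shift (ev v ^+ j) f.
  elim: M eM => //= M IH; rewrite mem_cat => /orP[/IH[j jM H]|/mapP[f fc ->]].
    by exists j => //; apply: ltnW.
  by exists M => //; exists f.
by apply: pow_visits => //; apply: c0_visits.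
Qed.

Lemma short_conjugator : exists2 s, evS s * evS u = evS v * evS s &
  (size s <= 36 * n ^ 2)%N.
Proof.
(* Walked out and back, [p] adds no flow but visits every vertex that [euler_walk] needs. This costs
   at most [32 * n ^ 2] letters and [support] at most [4 * n ^ 2], whence 36. *)
pose p := word_pow block (4 * n).
have pp1 : ev (p ++ word_inv p) = 1.
  by rewrite word_eval_cat word_eval_inv mulgV.
have [|||s sz_s [evs fl]] :=
    @euler_walk _ _ x support 1 (p ++ word_inv p) (ev t) [::].
- move=> e; rewrite mem_filter => /andP[_ /chain_visits ep].
  by left; apply: visits_catl.
- by rewrite pp1.
(* [support] has the boundary of the path of [w], which ends at [ev t], where the empty second half
   sits. *)
- move=> z; pose tau (y : G) := (y == z)%:Z%R.
  have := trail_sum x tau 1 w; rewrite mul1g wt => <-.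
  apply: eq_flow_sum => [e|]; last exact: flow_support.
  by rewrite edge_end_inv opprB.
exists s.
  suff -> : evS s = evS w by [].
  apply/magnus_eq => e; rewrite fl flow_support trail_cat flow_cat.
  by rewrite flow_trail_inv subrr add0r [flow _ [::] _]/flow /= subrr addr0.
have szf : (size support <= 4 * n * n)%N.
  rewrite -size_chain size_filter; exact: count_size.
move: szf; rewrite sz_s !size_cat size_word_inv size_word_pow /= => szf.
have szb : (size block <= 4 * n)%N.
  by rewrite !size_cat !size_word_inv /n; lia.
have : (4 * n * size block <= 4 * n * (4 * n))%N by rewrite leq_mul2l szb orbT.
by lia.
Qed.

End ShortConjugator.

Lemma conjugator_bound u v :
    (exists w, evS w * evS u = evS v * evS w) ->
  exists2 w, evS w * evS u = evS v * evS w &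
    (size w <= 36 * (size u + size v) ^ 2)%N.
Proof.
move=> [w wP]; have [v1|/eqP v1] := eqVneq (ev v) 1.
  have [t tP szt] := kernel_conjugator v1 wP.
  by exists t => //; apply: leq_trans szt _; rewrite -mulnn; nia.
have [w' [t [w'P w't szt]]] := conjugator_over_short v1 wP.
exact: short_conjugator w'P w't szt.
Qed.

End MagnusEmbedding.

(** * Flows of elements of the free group *)

Section FreeGroupFlow.
Variables (G : groupType) (I : finType) (x : I -> G).
Implicit Types (w : seq (I * bool)) (f : free_group I).

Lemma word_eval_cons_reduce a w :
  word_eval x (cons_reduce a w) = letter_eval x a * word_eval x w.
Proof.
case: w => [|b w] /=; first by rewrite word_eval_cons.
case: eqP => [->|_]; last exact: word_eval_cons.
by rewrite word_eval_cons letter_eval_inv mulVKg.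
Qed.

Lemma word_eval_reduce w : word_eval x (reduce w) = word_eval x w.
Proof.
by elim: w => //= a w IH; rewrite word_eval_cons_reduce IH word_eval_cons.
Qed.

Lemma flow_reduce g w e :
  flow x (trail x g (reduce w)) e = flow x (trail x g w) e.
Proof.
elim: w g => //= a w IH g.
rewrite -[(g, a) :: _]cat1s flow_cat -{}IH.
case: (reduce w) => [|b s]; first by rewrite -flow_cat.
rewrite [cons_reduce _ _]/=; case: eqP => [->|_]; last by rewrite -flow_cat.
rewrite [in RHS]/= -[X in (_ + flow _ X _)%R]cat1s flow_cat.
rewrite letter_eval_inv mulgK.
rewrite -[[:: (g * _, _)]]/(map (edge_inv x) [:: (g, a)]) flow_inv.
by rewrite addrA subrr add0r.
Qed.

Lemma free_word_eval w : free_word (word_eval (@free_gen I) w) = reduce w.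
Proof.
elim: w => [|a w IH]; first by rewrite word_eval_nil.
rewrite word_eval_cons [LHS]/= IH reduce_catr.
by case: a => i [].
Qed.

Lemma word_evalK f : word_eval (@free_gen I) (free_word f) = f.
Proof.
by apply: val_inj; rewrite /= free_word_eval reduce_id //; apply: valP.
Qed.

Definition free_eval f := word_eval x (free_word f).

Definition free_flow f (e : edge G I) := flow x (trail x 1 (free_word f)) e.

Lemma free_evalM f g : free_eval (f * g) = free_eval f * free_eval g.
Proof. by rewrite /free_eval /= word_eval_reduce word_eval_cat. Qed.

Lemma free_evalV f : free_eval f^-1 = (free_eval f)^-1.
Proof. exact: word_eval_inv. Qed.

Lemma free_flowM f g e : free_flow (f * g) e =
  (free_flow f e + free_flow g (edge_shift (free_eval f)^-1 e))%R.
Proof.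
by rewrite /free_flow /= flow_reduce trail_cat flow_cat mul1g -flow_trail.
Qed.

Lemma free_flowV f e : free_eval f = 1 ->
  free_flow f^-1 e = (- free_flow f e)%R.
Proof.
move=> f1; have := free_flowM f f^-1 e.
rewrite mulgV f1 invg1 edge_shift1 {1}/free_flow {1}/flow /= subrr.
by move/eqP; rewrite eq_sym addrC addr_eq0 => /eqP.
Qed.

(** On elements trivial in [G] no translation occurs, so the flow is additive there and, having
    abelian values, kills commutators. *)
Lemma commutator_flow (N : set (free_group I)) f :
  (forall h, N h -> free_eval h = 1) -> commutator_subgroup N N f ->
  free_eval f = 1 /\ forall e, free_flow f e = 0%R.
Proof.
move=> N1 Nf.
pose K : set (free_group I) :=
  [set h | free_eval h = 1 /\ forall e, free_flow h e = 0%R].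
apply: (Nf K); split.
  split.
  - by split=> [|e]; [exact: word_eval_nil | rewrite /free_flow /flow /= subrr].
  - move=> h k [h1 h0] [k1 k0]; split; first by rewrite free_evalM h1 k1 mulg1.
    by move=> e; rewrite free_flowM h0 k0 addr0.
  - move=> h [h1 h0]; split; first by rewrite free_evalV h1 invg1.
    by move=> e; rewrite free_flowV // h0 oppr0.
move=> _ [h [k [/N1 h1 /N1 k1 ->]]]; split.
  by rewrite !(free_evalM, free_evalV) h1 k1 !(invg1, mulg1).
move=> e; rewrite !free_flowM !free_evalV !free_flowV //.
rewrite h1 k1 !invg1 !edge_shift1.
by ring.
Qed.

End FreeGroupFlow.

(** * Free solvable groups *)

Section FreeSolvable.
Variable r : nat.

Local Notation evF := (word_eval (@free_gen 'I_r)).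
Local Notation gen d := (@free_solvable_gen r d).

Lemma free_solvable_eval d w :
  word_eval (gen d) w =
  quotient_proj (derived_normal (free_group 'I_r) d) (evF w).
Proof.
elim: w => [|a w IH]; first by rewrite !word_eval_nil.
rewrite !word_eval_cons IH -quotient_projM; congr (_ * _).
rewrite /letter_eval; case: a.2 => //.
by rewrite -quotient_projV.
Qed.

Lemma free_solvable_eval1 d w :
  word_eval (gen d) w = 1 <-> derived d (evF w).
Proof.
rewrite free_solvable_eval.
have := quotient_projP (derived_normal (free_group 'I_r) d) 1 (evF w).
by rewrite invg1 mul1g => <-; split=> /esym.
Qed.

(** One direction is [commutator_flow] with [N = derived d]; the other is [zero_flow_eval], as
    [N/[N,N]] is abelian. *)
Lemma free_solvable_magnus d w : word_eval (gen d.+1) w = 1 <->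
  forall e, flow (gen d) (trail (gen d) 1 w) e = 0%R.
Proof.
split=> [/free_solvable_eval1 w1 e|].
  have [|_ /(_ e)] := commutator_flow (x := gen d) _ w1.
    by move=> f fd; apply/free_solvable_eval1; rewrite word_evalK.
  by rewrite /free_flow free_word_eval flow_reduce.
apply: zero_flow_eval; first exact: free_solvable_generates.
move=> u v /free_solvable_eval1 u1 /free_solvable_eval1 v1.
rewrite !free_solvable_eval.
rewrite -[LHS]/(quotient_mul _ _) -[RHS]/(quotient_mul _ _) !quotient_projM.
apply/quotient_projP => H [_]; apply; exists (evF v), (evF u); split=> //.
by rewrite /commg /conjg invgM !mulgA.
Qed.

Lemma free_solvable_undistorted d : undistorted (gen d).
Proof.
(* Derived length 0 gives the trivial group, which has no nontrivial [v]. *)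
elim: d => [|d IH]; first by move=> v s k []; apply/free_solvable_eval1.
exact: undistorted_ext (@free_solvable_magnus d) IH.
Qed.

Lemma free_solvable_CLF d n : (CLF (gen d.+1) n <= 36 * n ^ 2)%N.
Proof.
have genS := @free_solvable_generates r d.+1.
have [[u [v [luv [w wP] ->]]] _] := CLFP genS n.
have [[wu eu su] _] := word_lengthP genS u.
have [[wv evv sv] _] := word_lengthP genS v.
have [|t tP st] := @conjugator_bound _ _ _ _ _ (@free_solvable_magnus d)
    (@free_solvable_undistorted d) wu wv.
  by have [s es] := genS w; exists s; rewrite es eu evv.
rewrite eu evv in tP; have uv : conjugate u v by exists w.
apply: leq_trans ((min_conjugatorP (gen d.+1) uv).2 _ tP) _.
apply: leq_trans ((word_lengthP genS _).2 _ erefl) _.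
by apply: leq_trans st _; rewrite leq_mul2l /= leq_sqr su sv.
Qed.

End FreeSolvable.

Local Close Scope group_scope.
Local Close Scope classical_set_scope.
Local Open Scope ring_scope.

Theorem theorem1 (R : realType) (r d : nat) (hr : (1 < r)%N) (hd : (1 < d)%N) :
  exists p : {poly R}, size p = 4%N /\
    forall n : nat, (CLF (@free_solvable_gen r d) n)%:R <= p.[n%:R].
Proof.
(* Since [n ^ 2 <= n ^ 3] for natural [n], the quadratic bound fits under a polynomial of degree
   exactly 3. *)
exists (36%:R *: 'X^3); split.
  by rewrite size_scale ?size_polyXn // pnatr_eq0.
move=> n; rewrite hornerZ hornerXn -natrX -natrM ler_nat.
case: d hd => // d _. apply: leq_trans (free_solvable_CLF r d n) _.
by case: n => // n; rewrite leq_mul2l leq_pexp2l.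
Qed.
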